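(* Let $\mathbf{A}$ be an $H_0^{\vee}$-algebra. Then the following conditions are equivalent: (1) $\mathbf{A}$ is a Stonean Hilbert algebra; (2) $a\veebar b=a\vee b$ for all $a,b\in R(A)$.
   Context: A Hilbert algebra is an algebra $\langle A,\to,1\rangle$ of type $(2,0)$ such that for all $a,b,c\in A$: $a\to(b\to a)=1$; $(a\to(b\to c))\to((a\to b)\to(a\to c))=1$; and $a\to b=b\to a=1$ implies $a=b$. Its natural order is: $a\le b$ iff $a\to b=1$. An $H^{\vee}$-algebra is an algebra $\langle A,\to,\vee,1\rangle$ where $\langle A,\to,1\rangle$ is a Hilbert algebra, $\langle A,\vee,1\rangle$ is a join-semilattice with greatest element $1$, and $a\to b=1$ iff $a\vee b=b$ for all $a,b$. An $H_0^{\vee}$-algebra is an $H^{\vee}$-algebra with an element $0$ such that $0\to a=1$ for all $a$; write $\neg a:=a\to 0$. A Stonean Hilbert algebra is an $H_0^{\vee}$-algebra satisfying $\neg a\vee\neg\neg a=1$ for all $a$. The set of regular elements is $R(A)=\{\neg a\colon a\in A\}=\{a\in A\colon\neg\neg a=a\}$. For $a,b\in R(A)$ put $a\veebar b:=\neg\neg(\neg a\to b)$. Here $\vee$ is the join of $\mathbf{A}$. *)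

(* Defs.v *)
(* Algebras are bundled over an arbitrary carrier type, with equations read as
   Leibniz equalities; MathComp's order structures are not used, since they
   require a choiceType carrier and a boolean order. *)
From mathcomp Require Import all_boot.

Set Implicit Arguments.
Unset Strict Implicit.
Unset Printing Implicit Defensive.

Declare Scope hilbert_scope.
Delimit Scope hilbert_scope with hilbert.
Local Open Scope hilbert_scope.

Reserved Notation "a ~> b" (at level 55, right associativity).
Reserved Notation "a \v/ b" (at level 50, left associativity).
Reserved Notation "a \veebar b" (at level 50, left associativity).
Reserved Notation "¬ a" (at level 35, right associativity).

Record hilbertAlgebra := HilbertAlgebra {
  hilbert_sort :> Type;
  himp : hilbert_sort -> hilbert_sort -> hilbert_sort;
  hone : hilbert_sort;
  himpK : forall a b, himp a (himp b a) = hone;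
  himpS : forall a b c,
    himp (himp a (himp b c)) (himp (himp a b) (himp a c)) = hone;
  himp_anti : forall a b, himp a b = hone -> himp b a = hone -> a = b
}.

Arguments hone {_}.

Notation "a ~> b" := (himp a b) : hilbert_scope.
Notation "1" := hone : hilbert_scope.

Record hvAlgebra := HvAlgebra {
  hv_hilbert :> hilbertAlgebra;
  hjoin : hv_hilbert -> hv_hilbert -> hv_hilbert;
  hjoinA : associative hjoin;
  hjoinC : commutative hjoin;
  hjoinxx : forall a, hjoin a a = a;
  hjoin1 : forall a, hjoin a 1 = 1;
  himp_join : forall a b, a ~> b = 1 <-> hjoin a b = b
}.

Notation "a \v/ b" := (hjoin a b) : hilbert_scope.

Record h0vAlgebra := H0vAlgebra {
  h0v_hv :> hvAlgebra;
  hzero : h0v_hv;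
  himp0 : forall a : h0v_hv, hzero ~> a = 1
}.

Arguments hzero {_}.

Notation "0" := hzero : hilbert_scope.

Definition hneg (A : h0vAlgebra) (a : A) : A := a ~> 0.

Notation "¬ a" := (hneg a) : hilbert_scope.

Definition stonean (A : h0vAlgebra) : Prop := forall a : A, ¬ a \v/ ¬ ¬ a = 1.

Definition regular (A : h0vAlgebra) (a : A) : Prop := exists b : A, a = ¬ b.

(* Given by the same formula on all of A; only its values on regular elements
   are meaningful. *)
Definition veebar (A : h0vAlgebra) (a b : A) : A := ¬ ¬ (¬ a ~> b).

Notation "a \veebar b" := (veebar a b) : hilbert_scope.

(* Main.v *)
Require Import Defs.
From mathcomp Require Import all_boot.

(** Under the Stonean identity, a regular [a] satisfies [¬ a \v/ a = 1], so the
    join of [A] admits a proof by cases on [¬ a] and [a]: an element above both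
    is [1].  Apply this to [(a \veebar b) ~> (a \v/ b)].  It is above [a]
    because [a <= a \v/ b]; it is above [¬ a] because double negation passes
    under an implication, so that [¬ ¬ (¬ a ~> b) <= ¬ a ~> ¬ ¬ b], where
    [¬ ¬ b = b] by regularity.  This gives [a \veebar b <= a \v/ b]; the reverse
    inequality holds in every algebra, because [¬ a ~> b] is above both [a]
    and [b].

    Conversely, [¬ a] and [¬ ¬ a] are regular, and their regular join is
    [¬ ¬ (¬ ¬ a ~> ¬ ¬ a) = ¬ ¬ 1 = 1].

    Here [x <= y] stands for [x ~> y = 1]. *)

Local Open Scope hilbert_scope.

Section JoinHilbert.

Local Set Implicit Arguments.
Local Unset Strict Implicit.

Variable A : hvAlgebra.
Implicit Types a b c : A.

Lemma himp_refl a : a ~> a = 1.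
Proof. by apply/himp_join; rewrite hjoinxx. Qed.

Lemma himp1 a : a ~> 1 = 1.
Proof. by apply/himp_join; rewrite hjoin1. Qed.

(** Modus ponens: antisymmetry applies because the join makes [1] the greatest
    element. *)
Lemma one_himp_eq1 a : 1 ~> a = 1 -> a = 1.
Proof. by move=> le1a; apply: himp_anti => //; apply: himp1. Qed.

Lemma himp_mp a b c : a ~> (b ~> c) = 1 -> a ~> b = 1 -> a ~> c = 1.
Proof.
move=> habc hab; have := himpS a b c.
by rewrite habc hab => /one_himp_eq1/one_himp_eq1.
Qed.

Lemma himp_trans b a c : a ~> b = 1 -> b ~> c = 1 -> a ~> c = 1.
Proof. by move=> hab hbc; apply: himp_mp hab; rewrite hbc himp1. Qed.

Lemma himp_weaken a b c : a ~> c = 1 -> a ~> (b ~> c) = 1.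
Proof. by move=> hac; apply: himp_trans hac _; apply: himpK. Qed.

(** The order form of distributivity, [a ~> (b ~> c) <= (a ~> b) ~> (a ~> c)],
    together with [b <= a ~> b]. *)
Lemma himp_exchange a b c : a ~> (b ~> c) = 1 -> b ~> (a ~> c) = 1.
Proof.
move=> habc; apply: (@himp_trans (a ~> b)); first exact: himpK.
by apply: one_himp_eq1; rewrite -{1}habc; apply: himpS.
Qed.

Lemma himp_eval a b : a ~> ((a ~> b) ~> b) = 1.
Proof. by apply: himp_exchange; apply: himp_refl. Qed.

Lemma himp_monor a b c : b ~> c = 1 -> (a ~> b) ~> (a ~> c) = 1.
Proof.
by move=> hbc; have := himpS a b c; rewrite hbc himp1 => /one_himp_eq1.
Qed.

Lemma himp_comp a b c : (b ~> c) ~> ((a ~> b) ~> (a ~> c)) = 1.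
Proof.
by apply: (@himp_trans (a ~> (b ~> c))); [apply: himpK | apply: himpS].
Qed.

Lemma himp_joinl a b : a ~> (a \v/ b) = 1.
Proof. by apply/himp_join; rewrite hjoinA hjoinxx. Qed.

Lemma himp_joinr a b : b ~> (a \v/ b) = 1.
Proof. by rewrite hjoinC himp_joinl. Qed.

Lemma join_himp a b c : a ~> c = 1 -> b ~> c = 1 -> (a \v/ b) ~> c = 1.
Proof.
by move=> /himp_join hac /himp_join hbc; apply/himp_join; rewrite -hjoinA hbc.
Qed.

Lemma join1_cases a b c : a \v/ b = 1 -> a ~> c = 1 -> b ~> c = 1 -> c = 1.
Proof.
by move=> hab hac hbc; have := join_himp hac hbc; rewrite hab => /one_himp_eq1.
Qed.

End JoinHilbert.

Section Negation.

Local Set Implicit Arguments.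
Local Unset Strict Implicit.

Variable A : h0vAlgebra.
Implicit Types a b c : A.

Lemma himp_negneg a : a ~> ¬ ¬ a = 1.
Proof. exact: himp_eval. Qed.

Lemma himp_contrap a b : (a ~> b) ~> (¬ b ~> ¬ a) = 1.
Proof. by apply: himp_exchange; apply: himp_comp. Qed.

Lemma neg_anti a b : a ~> b = 1 -> ¬ b ~> ¬ a = 1.
Proof.
by move=> hab; have := himp_contrap a b; rewrite hab => /one_himp_eq1.
Qed.

Lemma regular_negneg a : regular a -> ¬ ¬ a = a.
Proof.
case=> b ->; apply: himp_anti; last exact: himp_negneg.
by apply: neg_anti; apply: himp_negneg.
Qed.

Lemma negneg1 : ¬ ¬ (1 : A) = 1.
Proof. by apply: one_himp_eq1; apply: himp_negneg. Qed.

(** From [a] one gets [(a ~> b) ~> b]; contraposing twice turns it into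
    [¬ ¬ (a ~> b) ~> ¬ ¬ b]. *)
Lemma negneg_himp a b : ¬ ¬ (a ~> b) ~> (a ~> ¬ ¬ b) = 1.
Proof.
apply: himp_exchange; apply: himp_trans (himp_eval a b) _.
by apply: himp_trans (himp_contrap _ _) _; apply: himp_contrap.
Qed.

Lemma join_le_veebar a b : (a \v/ b) ~> (a \veebar b) = 1.
Proof.
apply: himp_trans (himp_negneg _); apply: join_himp; last exact: himpK.
by apply: himp_exchange; apply: himp_monor; apply: himp0.
Qed.

Lemma stonean_veebar_le_join a b :
  stonean A -> regular a -> regular b -> (a \veebar b) ~> (a \v/ b) = 1.
Proof.
move=> stA ra rb; apply: (@join1_cases A (¬ a) a).
- by rewrite -{2}(regular_negneg ra); apply: stA.
- apply: himp_exchange; rewrite /veebar.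
  apply: himp_trans (negneg_himp _ _) _; rewrite (regular_negneg rb).
  by apply: himp_monor; apply: himp_joinr.
- by apply: himp_weaken; apply: himp_joinl.
Qed.

End Negation.

Theorem theorem3p13 (A : h0vAlgebra) :
  stonean A <->
  (forall a b : A, regular a -> regular b -> a \veebar b = a \v/ b).
Proof.
split=> [stA a b ra rb | veebarE a].
  by apply: himp_anti; [apply: stonean_veebar_le_join | apply: join_le_veebar].
rewrite -veebarE; [|by exists a|by exists (¬ a)].
by rewrite /veebar himp_refl negneg1.
Qed.
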